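(* Let $R,S$ be Dedekind domains such that $G(R)$ and $G(S)$ are homeomorphic. Then the class group of $R$ is torsion if and only if the class group of $S$ is torsion.
   Context: A Dedekind domain is a one-dimensional Noetherian integrally closed domain. For an integral domain $R$, set $R^\bullet:=R\setminus\{0\}$. The Golomb space $G(R)$ is the set $R^\bullet$ endowed with the topology generated by the cosets $a+I$, where $a\in R$ and $I$ is a nonzero ideal of $R$ such that $\langle a,I\rangle=R$. The class group of $R$ is the group of nonzero fractional ideals of $R$ modulo principal fractional ideals. *)

(* Defs.v *)
From HB Require Import structures.
From mathcomp Require Import all_boot all_order all_algebra.
From mathcomp Require Import all_classical topology.

Set Implicit Arguments.
Unset Strict Implicit.
Unset Printing Implicit Defensive.

Import GRing.Theory.
Local Open Scope classical_set_scope.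
Local Open Scope ring_scope.

Section Ideals.
Variable R : idomainType.
Implicit Types (a : R) (A I P : set R).

(* As opposed to idealr_closed, the improper ideal R is allowed. *)
Definition is_ideal I :=
  I 0 /\ forall a x y, I x -> I y -> I (a * x + y).

Definition ideal_gen A : set R := smallest is_ideal A.

Definition nonzero_ideal I := is_ideal I /\ exists2 x, I x & x != 0.

Definition prime_ideal P :=
  [/\ is_ideal P, ~ P 1 & forall x y, P (x * y) -> P x \/ P y].

Definition prime_chain (n : nat) (P : 'I_n.+1 -> set R) :=
  (forall i, prime_ideal (P i)) /\
  (forall i j : 'I_n.+1, (i < j)%N -> P i `<` P j).

Definition coset a I : set R := [set a + x | x in I].

End Ideals.

Section Dedekind.
Variable R : idomainType.

Definition krull_dim_eq (d : nat) :=
  (exists P : 'I_d.+1 -> set R, prime_chain P) /\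
  (forall (n : nat) (P : 'I_n.+1 -> set R), prime_chain P -> (n <= d)%N).

Definition noetherian :=
  forall I : set R, is_ideal I ->
    exists2 A : set R, finite_set A & I = ideal_gen A.

Definition integrally_closed :=
  forall z : {fraction R}, integralOver (@tofrac R) z ->
    exists r : R, z = tofrac r.

Definition dedekind_domain :=
  [/\ krull_dim_eq 1, noetherian & integrally_closed].

End Dedekind.

Section ClassGroup.
Variable R : idomainType.
Notation K := {fraction R}.
Implicit Types I J : set K.

Definition is_submodule I :=
  I 0 /\ forall (a : R) (x y : K), I x -> I y -> I (tofrac a * x + y).

Definition nonzero_fractional_ideal I :=
  [/\ is_submodule I,
      exists2 x, I x & x != 0 &
      exists2 d : R, d != 0 &
        forall x, I x -> exists r : R, tofrac d * x = tofrac r].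

Definition fractional_ideal_mul I J : set K :=
  smallest is_submodule [set x * y | x in I & y in J].

Definition fractional_ideal_exp I (n : nat) : set K :=
  iter n (fractional_ideal_mul I) (range (@tofrac R)).

Definition principal_fractional_ideal I :=
  exists2 c : K, c != 0 & I = [set c * tofrac r | r in [set: R]].

(* In the quotient of the group of nonzero fractional ideals by the subgroup
   of principal ones, the n-th power of the class of I is trivial exactly when
   I ^ n lies in that subgroup. *)
Definition torsion_class_group :=
  forall I, nonzero_fractional_ideal I ->
    exists2 n : nat, (0 < n)%N &
      principal_fractional_ideal (fractional_ideal_exp I n).

End ClassGroup.

Arguments torsion_class_group : clear implicits.
Arguments dedekind_domain : clear implicits.

Definition golomb (R : idomainType) : Type := {x : R | x != 0}.

(* The trace on R \ {0} is only needed when I = R: if I is proper, then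
   <a, I> = R forces 0 not to be in a + I. *)
Definition golomb_subbase (R : idomainType) : set (set (golomb R)) :=
  [set U | exists (a : R) (I : set R),
    [/\ nonzero_ideal I, ideal_gen ([set a] `|` I) = [set: R] &
        U = (fun x : golomb R => sval x) @^-1` coset a I]].

HB.instance Definition _ (R : idomainType) :=
  Choice.copy (golomb R) {x : R | x != 0}.
HB.instance Definition _ (R : idomainType) :=
  isSubBaseTopological.Build (golomb R) (@golomb_subbase R) id.

Definition homeomorphic (X Y : topologicalType) :=
  exists (f : X -> Y) (g : Y -> X),
    [/\ cancel f g, cancel g f, continuous f & continuous g].

(* Main.v *)
Require Import Defs.
From mathcomp Require Import all_boot all_order all_algebra finmap.
From mathcomp Require Import all_classical topology.
From mathcomp Require Import ring.

(** For a nonzero [x], let [V(x)] be the set of nonzero primes containing [x].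
The proof shows that the topology of [G(R)] almost determines the preorder
[V(y) <= V(x)], and that torsion of the class group is a property of this
preorder.

The link with the topology is through closures.  In [G(R)] the closure of
[x + P^e], for a prime [P] not containing [x], is [P] together with
[x + P^e] ([closure_gcoset_congr], [closure_gcoset_in]).  If [y] and [z] are
two distinct points outside [P], the closures of [y + P^N] and [z + P^N] meet
only inside [P] as soon as [P^N] separates [y] from [z]; points inside [P],
on the other hand, have neighbourhoods that say nothing modulo powers of [P].
Hence, for [x], [y], [z] distinct, the closed neighbourhoods of [y] and [z]
have intersections as small as any closed neighbourhood of [x] ([dominated])
if and only if [V(y)] and [V(z)] are contained in [V(x)]
([dominated_supp_le], [supp_le_dominated]).  This recovers [V(y) <= V(x)]
once there is room for the auxiliary point [z].  Room can be lacking only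
when [x] is a unit and [R] has few units; calling the other points [ample],
and comparing only with ample points, avoids the problem ([ample_below]).

On the algebraic side, the class group is torsion if and only if every
nonzero prime [P] is the only nonzero prime containing some [x], that is,
[V(x) = {P}] ([torsion_iff_isolated]): such an [x] generates a power of [P],
and every ideal is a product of primes.  In terms of the preorder, where
[V(bc)] is the union of [V(b)] and [V(c)], an element [p] with
[V(p) = {P}] is join-prime, and conversely a join-prime [p] has at most one
prime, because two distinct primes in [V(p)] can be split between two elements
[b] and [c] with [b + c = 1] ([join_prime_support]).  So the singletons among
the [V(p)] are visible in the preorder.  If all primes are isolated, then
[V(x)] is determined by the join-primes below it.  If [P] is not isolated, take
[x] in [P] and [y] outside [P] but in all other primes of [V(x)]: every
join-prime below [x] is below [y], and [x] is not below [y]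
([torsion_iff_separate]).

The ideal theory of Dedekind domains that is needed (factorization into
primes, trivial intersection of the powers of a prime) comes from one
consequence of integral closedness: an element of the fraction field that
stabilizes a nonzero ideal lies in the ring ([stabilizer_integral]). *)

Set Implicit Arguments.
Unset Strict Implicit.
Unset Printing Implicit Defensive.

Import GRing.Theory.
Local Open Scope classical_set_scope.
Local Open Scope ring_scope.

(** * Ideals, products, powers, coprimality *)

Section IdealTheory.
Variable R : idomainType.
Implicit Types (a b c r x y z : R) (A B I J P Q : set R).

Lemma ideal0 I : is_ideal I -> I 0. Proof. by case. Qed.

Lemma ideal_mull I a x : is_ideal I -> I x -> I (a * x).
Proof. by case=> I0 IL Ix; rewrite -[a * x]addr0; apply: IL. Qed.

Lemma ideal_mulr I a x : is_ideal I -> I x -> I (x * a).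
Proof. by move=> hI Ix; rewrite mulrC; apply: ideal_mull. Qed.

Lemma idealD I x y : is_ideal I -> I x -> I y -> I (x + y).
Proof. by case=> I0 IL Ix Iy; rewrite -[x]mul1r; apply: IL. Qed.

Lemma idealN I x : is_ideal I -> I x -> I (- x).
Proof. by move=> hI Ix; rewrite -mulN1r; apply: ideal_mull. Qed.

Lemma idealB I x y : is_ideal I -> I x -> I y -> I (x - y).
Proof. by move=> hI Ix Iy; apply: idealD => //; apply: idealN. Qed.

Lemma ideal_subl I x y : is_ideal I -> I (x - y) -> I x -> I y.
Proof.
by move=> hI Ixy Ix; have := idealB hI Ix Ixy; rewrite opprB addrC subrK.
Qed.

Lemma idealT : is_ideal ([set: R]). Proof. by []. Qed.

Lemma ideal_unit I : is_ideal I -> I 1 -> I = setT.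
Proof.
move=> hI I1; apply/seteqP; split=> // x _.
by rewrite -[x]mulr1; apply: ideal_mull.
Qed.

Lemma ideal_gen_ideal A : is_ideal (ideal_gen A).
Proof.
split=> [I [[I0 _] _] //|a x y hx hy I hI].
by case: (hI) => -[_ IL] _; apply: IL; [apply: hx | apply: hy].
Qed.

Lemma ideal_colon I a : is_ideal I -> is_ideal [set x | I (a * x)].
Proof.
move=> hI; split=> /= [|r x y Ix Iy]; first by rewrite mulr0; apply: ideal0.
by rewrite mulrDr mulrCA; apply: idealD => //; apply: ideal_mull.
Qed.

Definition principal a : set R := [set a * r | r in [set: R]].

Lemma principal_ideal a : is_ideal (principal a).
Proof.
split; first by exists 0; rewrite ?mulr0.
by move=> r _ _ [u _ <-] [v _ <-]; exists (r * u + v) => //; ring.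
Qed.

Lemma principal_gen a : principal a a.
Proof. by exists 1; rewrite ?mulr1. Qed.

Lemma principal_nonzero a : a != 0 -> nonzero_ideal (principal a).
Proof.
by move=> a0; split; [apply: principal_ideal | exists a => //; apply: principal_gen].
Qed.

Definition adjoin I x : set R := [set z | exists2 i, I i & exists r, z = i + r * x].

Lemma adjoin_ideal I x : is_ideal I -> is_ideal (adjoin I x).
Proof.
move=> hI; split; first by exists 0; [apply: ideal0 | exists 0; ring].
move=> a _ _ [i Ii [r ->]] [j Ij [s ->]].
exists (a * i + j); first by apply: idealD => //; apply: ideal_mull.
by exists (a * r + s); ring.
Qed.

Lemma sub_adjoin I x : I `<=` adjoin I x.
Proof. by move=> i Ii; exists i => //; exists 0; ring. Qed.

Lemma adjoin_gen I x : is_ideal I -> adjoin I x x.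
Proof. by move=> hI; exists 0; [apply: ideal0 | exists 1; ring]. Qed.

Lemma nonzero_sub I J : is_ideal J -> nonzero_ideal I -> I `<=` J ->
  nonzero_ideal J.
Proof. by move=> hJ [_ [x Ix x0]] IJ; split=> //; exists x => //; apply: IJ. Qed.

Definition imul I J : set R := ideal_gen [set x * y | x in I & y in J].

Lemma imul_ideal I J : is_ideal (imul I J).
Proof. exact: ideal_gen_ideal. Qed.

Lemma imul_in I J x y : I x -> J y -> imul I J (x * y).
Proof. by move=> Ix Jy; apply: sub_gen_smallest; exists x => //; exists y. Qed.

Lemma imul_sub I J A : is_ideal A ->
  (forall x y, I x -> J y -> A (x * y)) -> imul I J `<=` A.
Proof. by move=> hA IJA; apply: smallest_sub => // _ [x Ix [y Jy <-]]; apply: IJA. Qed.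

Lemma imulC I J : imul I J = imul J I.
Proof.
by apply/seteqP; split; apply: imul_sub => [|x y hx hy]; rewrite 1?mulrC;
  do ?[exact: imul_ideal | exact: imul_in].
Qed.

Lemma imulA I J A : imul I (imul J A) = imul (imul I J) A.
Proof.
have sub B C D : imul B (imul C D) `<=` imul (imul B C) D.
  apply: imul_sub => [|x y Bx]; first exact: imul_ideal.
  apply: (@imul_sub _ _ [set y | imul (imul B C) D (x * y)]) => [|c d Cc Dd].
    by apply: ideal_colon; exact: imul_ideal.
  by rewrite /= mulrA; apply: imul_in => //; apply: imul_in.
apply/seteqP; split; first exact: sub.
by rewrite [imul (imul I J) A]imulC [imul I J]imulC [imul I _]imulC [imul J A]imulC;
  exact: sub.
Qed.

Lemma imulT I : is_ideal I -> imul setT I = I.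
Proof.
move=> hI; apply/seteqP; split; first by apply: imul_sub => // x y _; apply: ideal_mull.
by move=> x Ix; rewrite -[x]mul1r; apply: imul_in.
Qed.

Lemma imul_subl I J : is_ideal I -> imul I J `<=` I.
Proof. by move=> hI; apply: imul_sub => // x y Ix _; apply: ideal_mulr. Qed.

Lemma imul_subr I J : is_ideal J -> imul I J `<=` J.
Proof. by rewrite imulC; exact: imul_subl. Qed.

Lemma imul_principal a b : imul (principal a) (principal b) = principal (a * b).
Proof.
apply/seteqP; split.
  apply: imul_sub => [|_ _ [r _ <-] [s _ <-]]; first exact: principal_ideal.
  by exists (r * s) => //; ring.
by move=> _ [r _ <-]; rewrite -mulrA; apply: imul_in;
  [exact: principal_gen | exists r].
Qed.

Definition ipow I n : set R := iter n (imul I) setT.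

Lemma ipow_ideal I n : is_ideal (ipow I n).
Proof. by case: n => [|n]; [exact: idealT | exact: imul_ideal]. Qed.

Lemma ipowS I n : ipow I n.+1 = imul I (ipow I n). Proof. by []. Qed.

Lemma ipow1 I : is_ideal I -> ipow I 1 = I.
Proof. by move=> hI; rewrite ipowS imulC imulT. Qed.

Lemma ipowD I m n : ipow I (m + n) = imul (ipow I m) (ipow I n).
Proof.
elim: m => [|m IH]; first by rewrite imulT //; exact: ipow_ideal.
by rewrite addSn !ipowS IH imulA.
Qed.

Lemma ipow_anti I m n : (m <= n)%N -> ipow I n `<=` ipow I m.
Proof. by move=> /subnKC <-; rewrite ipowD; apply: imul_subl; apply: ipow_ideal. Qed.

Lemma ipowM I m n : ipow I (m * n) = ipow (ipow I m) n.
Proof. by elim: n => [|n IH]; rewrite ?muln0 // mulnS ipowD IH. Qed.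

Lemma ipow_imul I J n : ipow (imul I J) n = imul (ipow I n) (ipow J n).
Proof.
elim: n => [|n IH]; first by rewrite /= imulT //; exact: idealT.
rewrite !ipowS IH -!imulA; congr imul; rewrite !imulA; congr imul; exact: imulC.
Qed.

Lemma ipow_principal a n : ipow (principal a) n = principal (a ^+ n).
Proof.
elim: n => [|n IH]; last by rewrite ipowS IH imul_principal exprS.
apply/seteqP; split=> // x _; exists x => //; ring.
Qed.

Lemma ipowT n : ipow [set: R] n = setT.
Proof. by elim: n => // n IH; rewrite ipowS IH imulT. Qed.

Lemma ipow_in I x n : I x -> ipow I n (x ^+ n).
Proof. by move=> Ix; elim: n => // n IH; rewrite exprS; apply: imul_in. Qed.

Lemma ipow_mono I J n : I `<=` J -> ipow I n `<=` ipow J n.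
Proof.
move=> IJ; elim: n => // n IH; apply: imul_sub => [|x y Ix Iy].
  exact: imul_ideal.
by apply: imul_in; [apply: IJ | apply: IH].
Qed.

Lemma imul_nonzero I J : nonzero_ideal I -> nonzero_ideal J ->
  nonzero_ideal (imul I J).
Proof.
move=> [hI [x Ix x0]] [hJ [y Jy y0]]; split; first exact: imul_ideal.
by exists (x * y); [exact: imul_in | rewrite mulf_neq0].
Qed.

Lemma ipow_nonzero I n : nonzero_ideal I -> nonzero_ideal (ipow I n).
Proof.
move=> hI; elim: n => [|n IH]; last exact: imul_nonzero.
by split=> //; exists 1 => //; exact: oner_neq0.
Qed.

Definition coprime_to x I := exists r i, I i /\ 1 = x * r + i.

Lemma coprime_toP x I : is_ideal I ->
  ideal_gen ([set x] `|` I) = [set: R] <-> coprime_to x I.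
Proof.
move=> hI; split=> [e|[r [i [Ii e]]]].
  have : ideal_gen ([set x] `|` I) `<=` adjoin I x.
    apply: smallest_sub; first exact: adjoin_ideal.
    by move=> z [->|/sub_adjoin //]; exact: adjoin_gen.
  by rewrite e => /(_ 1 Logic.I) [i Ii [r er]]; exists r, i; rewrite er; split=> //; ring.
apply: ideal_unit; first exact: ideal_gen_ideal.
have hg := ideal_gen_ideal ([set x] `|` I).
rewrite e; apply: (idealD hg); last by apply: sub_gen_smallest; right.
by apply: (ideal_mulr _ hg); apply: sub_gen_smallest; left.
Qed.

Lemma coprime_to_imul x I J :
  coprime_to x I -> coprime_to x J -> coprime_to x (imul I J).
Proof.
move=> [r [i [Ii ei]]] [s [j [Jj ej]]].
exists (r * x * s + r * j + i * s), (i * j); split; first exact: imul_in.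
by rewrite -[1]mulr1 {1}ei ej; ring.
Qed.

Lemma coprime_to_ipow x I n : coprime_to x I -> coprime_to x (ipow I n).
Proof.
move=> h; elim: n => [|n IH]; last exact: coprime_to_imul.
by exists 0, 1; split=> //; ring.
Qed.

Lemma coprime_to_exp x I n : is_ideal I -> coprime_to x I -> coprime_to (x ^+ n) I.
Proof.
move=> hI [r [i [Ii e]]]; elim: n => [|n [s [j [Ij es]]]].
  by exists 1, 0; split; [exact: ideal0 | ring].
exists (r * s), (x * r * j + i); split.
  by apply: idealD => //; apply: ideal_mull.
by rewrite e -[in LHS](mulr1 (x * r)) {1}es exprS; ring.
Qed.

End IdealTheory.

(** * Noetherian induction and dimension one *)

Section Noetherian.
Variable R : idomainType.
Hypothesis noethR : noetherian R.
Implicit Types (a b c r x y z : R) (A B I J P Q : set R).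

Lemma noetherian_seq I : is_ideal I -> exists s : seq R, I = ideal_gen [set` s].
Proof.
by move=> /noethR [A /finite_seqP [s ->] ->]; exists s.
Qed.

(** If a failing ideal existed, dependent choice would give a strictly
increasing sequence of failing ideals; the union is finitely generated, so the
sequence is stationary. *)
Lemma noetherian_ind (C : set R -> Prop) :
  (forall I, is_ideal I ->
     (forall J, is_ideal J -> I `<=` J -> I <> J -> C J) -> C I) ->
  forall I, is_ideal I -> C I.
Proof.
move=> step I hI; apply: contrapT => nCI.
pose T := {J : set R | is_ideal J /\ ~ C J}.
have next (t : T) : exists u : T, sval t `<=` sval u /\ sval t <> sval u.
  case: t => J [hJ nCJ] /=; apply: contrapT => nex; apply: nCJ.
  apply: step => // A hA JA neJA; apply: contrapT => nCA; apply: nex.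
  by exists (exist _ A (conj hA nCA)).
have [f hf] := choice next.
pose u n := sval (iter n f (exist _ I (conj hI nCI)) : T).
have uS n : u n `<=` u n.+1 /\ u n <> u n.+1 by apply: hf.
have uid n : is_ideal (u n) by rewrite /u; case: (iter _ _ _) => ? [].
have umono m n : (m <= n)%N -> u m `<=` u n.
  move=> /subnKC <-; elim: (n - m)%N => [|k IH]; first by rewrite addn0.
  by rewrite addnS => x /IH; apply: (uS _).1.
pose U : set R := [set x | exists n, u n x].
have Uid : is_ideal U.
  split; first by exists 0; apply: ideal0.
  move=> a x y [m xm] [n yn]; exists (maxn m n).
  apply: idealD => //; last exact: umono (leq_maxr _ _) _ yn.
  by apply: ideal_mull => //; exact: umono (leq_maxl _ _) _ xm.
have [s Us] := noetherian_seq Uid.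
have [N sN] : exists N, [set` s] `<=` u N.
  have : [set` s] `<=` U by rewrite Us; apply: sub_gen_smallest.
  elim: {Us} s => [|x s IH] sU; first by exists 0.
  have [N sN] : exists N, [set` s] `<=` u N.
    by apply: IH => y ys; apply: sU; rewrite /= in_cons [_ \in _]ys orbT.
  have [M xM] : U x by apply: sU; rewrite /= mem_head.
  exists (maxn M N) => y /=; rewrite in_cons => /orP[/eqP ->|ys].
    exact: umono (leq_maxl _ _) _ xM.
  exact: umono (leq_maxr _ _) _ (sN _ ys).
apply: (uS N).2; apply/seteqP; split; first exact: (uS N).1.
apply: (@subset_trans _ U); first by move=> x; exists N.+1.
by rewrite Us; apply: smallest_sub.
Qed.

Definition nonzero_prime P := prime_ideal P /\ exists2 x, P x & x != 0.

Lemma nonzero_prime_ideal P : nonzero_prime P -> nonzero_ideal P.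
Proof. by case=> -[hP _ _]. Qed.

Lemma prime_exp P x n : prime_ideal P -> P (x ^+ n) -> P x.
Proof.
case=> hP nP1 Pm; elim: n => [|n IH]; first by rewrite expr0 => /nP1.
by rewrite exprS => /Pm [|].
Qed.

Lemma not_prime_split I : is_ideal I -> ~ I 1 -> ~ prime_ideal I ->
  exists x y, [/\ I (x * y), ~ I x & ~ I y].
Proof.
move=> hI nI1 nprime; apply: contrapT => nex; apply: nprime; split=> // x y Ixy.
apply: contrapT => /not_orP [nIx nIy]; apply: nex; by exists x, y.
Qed.

Lemma adjoin_neq I x : is_ideal I -> ~ I x -> I <> adjoin I x.
Proof. by move=> hI nIx e; apply: nIx; rewrite e; apply: adjoin_gen. Qed.

(** By induction from above: when [I] is not prime, [xy] is in [I] for some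
[x], [y] outside [I], and [I + xR], [I + yR] cannot both be the whole ring, as
their product lies in [I]. *)
Lemma prime_over I : nonzero_ideal I -> ~ I 1 ->
  exists2 P, nonzero_prime P & I `<=` P.
Proof.
move=> [hI]; move: I hI; apply: noetherian_ind => I hI IH nzI nI1.
have nzJ J : I `<=` J -> exists2 x, J x & x != 0.
  by move=> IJ; case: nzI => x /IJ Jx x0; exists x.
have [|/(not_prime_split hI nI1) [x [y [Ixy nIx nIy]]]] := pselect (prime_ideal I).
  by exists I.
have up z : ~ I z -> ~ adjoin I z 1 -> exists2 P, nonzero_prime P & I `<=` P.
  move=> nIz nJ1; have [||||P hP JP] := IH (adjoin I z) _ _ _ _ nJ1.
  - exact: adjoin_ideal.
  - exact: sub_adjoin.
  - exact: adjoin_neq.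
  - exact/nzJ/sub_adjoin.
  - by exists P => //; apply: subset_trans JP; apply: sub_adjoin.
have [xI1|] := pselect (adjoin I x 1); last exact: up.
have [yI1|] := pselect (adjoin I y 1); last exact: up.
exfalso; apply: nI1; case: xI1 => i Ii [r ei]; case: yI1 => j Ij [s ej].
have -> : (1 : R) = i * (j + s * y) + (r * x * j + r * s * (x * y)).
  by rewrite -[1]mulr1 {1}ei ej; ring.
apply: (idealD hI); first exact: (ideal_mulr _ hI Ii).
by apply: (idealD hI); apply: ideal_mull.
Qed.

End Noetherian.

Section DimensionOne.
Variable R : idomainType.
Hypotheses (noethR : noetherian R) (dimR : krull_dim_eq R 1).
Implicit Types (a b c r x y z : R) (A B I J P Q : set R).

Lemma zero_prime : prime_ideal [set (0 : R)].
Proof.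
split.
- by split=> // a x y /= -> ->; rewrite mulr0 addr0.
- by move=> /= /eqP; rewrite oner_eq0.
- by move=> x y /= /eqP; rewrite mulf_eq0 => /orP[] /eqP ->; [left | right].
Qed.

(** A strict inclusion would give the chain [0 < P < Q] of length two. *)
Lemma nonzero_prime_max P Q : nonzero_prime P -> prime_ideal Q -> P `<=` Q ->
  P = Q.
Proof.
move=> [hP [x Px x0]] hQ PQ; apply: contrapT => nPQ.
pose ch (i : 'I_3) : set R :=
  if val i is i'.+1 then (if i' is 0%N then P else Q) else [set 0].
have lt0P : [set (0 : R)] `<` P.
  split; first by move=> _ ->; case: hP => /ideal0.
  by move=> /(_ _ Px) /eqP; rewrite (negPf x0).
have ltPQ : P `<` Q by split=> // QP; apply: nPQ; apply/seteqP.
suff /(dimR.2 2 ch) : prime_chain ch by [].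
split=> [[[|[|[|i]]] lti] //=|]; first exact: zero_prime.
move=> [[|[|[|i]]] lti] [[|[|[|j]]] ltj] //= _.
split; first exact: subset_trans lt0P.1 ltPQ.1.
by move=> Q0; apply: lt0P.2; apply: subset_trans Q0.
Qed.

Lemma prime_maximal P u : nonzero_prime P -> ~ P u -> coprime_to u P.
Proof.
move=> hP nPu; have [[idP nP1 _] _] := hP.
have idJ := adjoin_ideal u idP.
have [[i Pi [r e]]|nJ1] := pselect (adjoin P u 1).
  by exists r, i; split=> //; rewrite e; ring.
have nzJ : nonzero_ideal (adjoin P u).
  exact: nonzero_sub idJ (nonzero_prime_ideal hP) (@sub_adjoin _ _ _).
have [Q [hQ _] JQ] := prime_over noethR nzJ nJ1.
have PQ : P = Q.
  by apply: nonzero_prime_max => //; apply: subset_trans JQ; apply: sub_adjoin.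
by exfalso; apply: nPu; rewrite PQ; apply: JQ; apply: adjoin_gen.
Qed.

Lemma coprime_toPn x I : nonzero_ideal I -> ~ coprime_to x I ->
  exists P, [/\ nonzero_prime P, I `<=` P & P x].
Proof.
move=> nzI ncop; have [hI _] := nzI; have idJ := adjoin_ideal x hI.
have nzJ : nonzero_ideal (adjoin I x) by exact: nonzero_sub idJ nzI (@sub_adjoin _ _ _).
have [|P hP JP] := prime_over noethR nzJ.
  by case=> i Ii [r e]; apply: ncop; exists r, i; split=> //; rewrite e; ring.
exists P; split=> //; first by apply: subset_trans JP; apply: sub_adjoin.
by apply: JP; apply: adjoin_gen.
Qed.

(** An ideal becomes a power of [P] after localization at [P]; [c] is a common
denominator.  This is the only form in which primary decomposition is needed
below, and Noetherian induction proves it before any invertibility is known. *)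
Lemma prime_part I P : nonzero_ideal I -> nonzero_prime P ->
  exists c k, ~ P c /\ forall p, ipow P k p -> I (c * p).
Proof.
move=> [hI]; move: I hI; apply: noetherian_ind => // I hI IH nzI hP.
have [[idP nP1 primeP] _] := hP.
have [I1|nI1] := pselect (I 1).
  by exists 1, 0; split=> // p _; rewrite (ideal_unit hI I1).
have [prI|/(not_prime_split hI nI1) [x [y [Ixy nIx nIy]]]] := pselect (prime_ideal I).
  have [IP|nIP] := pselect (I `<=` P).
    have -> := nonzero_prime_max (conj prI nzI) hP.1 IP.
    by exists 1, 1%N; split=> // p; rewrite ipow1 // mul1r.
  have [c] : exists c, I c /\ ~ P c.
    apply: contrapT => nex; apply: nIP => c Ic.
    by apply: contrapT => nPc; apply: nex; exists c.
  by case=> Ic nPc; exists c, 0; split=> // p _; apply: ideal_mulr.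
have up z : ~ I z -> exists c k, ~ P c /\ forall p, ipow P k p -> adjoin I z (c * p).
  move=> nIz; apply: IH => //;
    [exact: adjoin_ideal | exact: sub_adjoin | exact: adjoin_neq | ].
  by case: nzI => w Iw w0; exists w => //; apply: sub_adjoin.
have [c [k [nPc hc]]] := up x nIx; have [d [l [nPd hd]]] := up y nIy.
exists (c * d), (k + l)%N; split; first by move=> /primeP [].
rewrite ipowD; apply: (@imul_sub _ _ _ [set p | I (c * d * p)]).
  exact: ideal_colon.
move=> p q /hc [i Ii [r ei]] /hd [j Ij [s ej]] /=.
have -> : c * d * (p * q) = i * (j + s * y) + (r * x * j + r * s * (x * y)).
  by rewrite mulrACA ei ej; ring.
apply: (idealD hI); first exact: (ideal_mulr _ hI Ii).
by apply: (idealD hI); apply: ideal_mull.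
Qed.

End DimensionOne.

(** * Dedekind domains *)

Section Dedekind.
Variable R : idomainType.
Hypothesis dedR : dedekind_domain R.
Implicit Types (a b c r x y z : R) (A B I J P Q : set R).

Let dimR : krull_dim_eq R 1. Proof. by case: dedR. Qed.
Let noethR : noetherian R. Proof. by case: dedR. Qed.
Let intR : integrally_closed R. Proof. by case: dedR. Qed.

Lemma ideal_gen_seq (s : seq R) x : ideal_gen [set` s] x ->
  exists c : 'I_(size s) -> R, x = \sum_i c i * s`_i.
Proof.
apply: (smallest_sub (X := [set x | exists c : 'I_(size s) -> R, x = \sum_i c i * s`_i])).
  split; first by exists (fun=> 0); rewrite big1 // => i _; rewrite mul0r.
  move=> a _ _ [c ->] [d ->]; exists (fun i => a * c i + d i).
  rewrite mulr_sumr -big_split /=; apply: eq_bigr => i _; ring.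
move=> y /= ys; have lt_i : (index y s < size s)%N by rewrite index_mem.
exists (fun i => (i == Ordinal lt_i)%:R).
rewrite (bigD1 (Ordinal lt_i)) //= eqxx mul1r nth_index // big1 ?addr0 // => i ni.
by rewrite (negPf ni) mul0r.
Qed.

Lemma ideal_transporter I a b : is_ideal I ->
  is_ideal [set x | exists2 y, I y & b * x = a * y].
Proof.
move=> hI; split; first by exists 0; [exact: ideal0 | rewrite !mulr0].
move=> r x y [x' Ix' ex] [y' Iy' ey]; exists (r * x' + y').
  by apply: idealD => //; apply: ideal_mull.
by rewrite mulrDr mulrCA ex ey; ring.
Qed.

(** The hypothesis says that [b / a] stabilizes the finitely generated module
[I].  It is then an eigenvalue of a matrix with entries in [R], hence a root
of a monic characteristic polynomial, hence in [R]. *)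
Lemma stabilizer_integral I a b : nonzero_ideal I -> a != 0 ->
  (forall x, I x -> exists2 y, I y & b * x = a * y) -> principal a b.
Proof.
move=> [hI [x Ix x0]] a0 stab; have [s Is] := noetherian_seq noethR hI.
pose n := size s; pose g : 'rV[{fraction R}]_n := \row_i tofrac s`_i.
have gen i : I s`_(i : 'I_n) by rewrite Is; apply: sub_gen_smallest; apply: mem_nth.
have [M hM] : exists M : 'I_n -> 'I_n -> R,
    forall i : 'I_n, b * s`_i = a * \sum_j M i j * s`_j.
  apply: (@fin_all_exists _ (fun=> 'I_n -> R)
    (fun (i : 'I_n) (c : 'I_n -> R) => b * s`_i = a * \sum_j c j * s`_j)) => i.
  have [y Iy ->] := stab _ (gen i).
  by move: Iy; rewrite Is => /ideal_gen_seq [c ->]; exists c.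
(* Row vectors act on the left, hence the transpose of [M]. *)
pose A : 'M[R]_n := \matrix_(i, j) M j i.
pose z : {fraction R} := tofrac b / tofrac a.
have a0' : tofrac a != 0 by rewrite tofrac_eq0.
have eig : g *m map_mx (@tofrac R) A = z *: g.
  apply/rowP => i; rewrite !mxE /z; apply: (mulfI a0').
  rewrite [RHS]mulrA [_ * (tofrac b / _)]mulrCA mulfV // mulr1 -tofracM hM tofracM.
  congr (_ * _); rewrite rmorph_sum; apply: eq_bigr => j _ /=.
  by rewrite !mxE tofracM mulrC.
have g0 : g != 0.
  apply: contra_neq x0 => g0; move: Ix; rewrite Is => /ideal_gen_seq [c ->].
  rewrite big1 // => i _; have /rowP/(_ i) := g0; rewrite !mxE => /eqP.
  by rewrite tofrac_eq0 => /eqP ->; rewrite mulr0.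
have /intR [r er] : integralOver (@tofrac R) z.
  exists (char_poly A); first exact: char_poly_monic.
  rewrite map_char_poly -eigenvalue_root_char.
  by apply/eigenvalueP; exists g.
exists r => //; apply/eqP; rewrite -tofrac_eq tofracM -er /z mulrC divfK //.
Qed.

(** Invertibility of [P], without fractional ideals: [b / a] is an element of
[P^-1] outside [R], and [q] witnesses that [P^-1 P] is not inside [P].  To find
[b], choose [a] in [P] and [c] outside [P] with [c P^k] inside [aR]; a
product of [c] with an element of [P^j], for the largest [j] such that
[c P^j] is not inside [aR], is suitable. *)
Lemma prime_inverse P : nonzero_prime P -> exists a b q d,
  [/\ a != 0, ~ principal a b, forall p, P p -> principal a (b * p),
      P q /\ ~ P d & b * q = a * d].
Proof.
move=> hP; have [[idP nP1 primeP] [a Pa a0]] := hP.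
have [c [k [nPc hc]]] := prime_part noethR dimR (principal_nonzero a0) hP.
have [b nab hb] : exists2 b, ~ principal a b & forall p, P p -> principal a (b * p).
  elim: k hc => [|k IH] hc.
    exfalso; apply: nPc; have [r _ e] := hc 1 Logic.I.
    by rewrite -[c]mulr1 -e; apply: ideal_mulr.
  have [|] := pselect (forall p, ipow P k p -> principal a (c * p)); first exact: IH.
  move=> /existsNP [p /not_implyP [Pkp nacp]].
  exists (c * p) => // q Pq; rewrite -mulrA [p * q]mulrC.
  by apply: hc; exact: imul_in.
exists a, b; apply: contrapT => nex; apply: (nab).
apply: (stabilizer_integral (nonzero_prime_ideal hP) a0) => q Pq.
have [d _ ed] := hb q Pq; exists d; last by rewrite ed.
by apply: contrapT => nPd; apply: nex; exists q, d; split.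
Qed.

(** If [c] is in all the [P^n], then [c (b / a)^n] is in [R] for all [n], with
[b / a] in [P^-1] but not in [R].  These elements generate a nonzero ideal
stabilized by [b / a], which is impossible. *)
Lemma krull_intersection P c : nonzero_prime P -> c != 0 -> exists N, ~ ipow P N c.
Proof.
move=> hP c0; apply: contrapT => /forallNP/= allN.
have {}allN n : ipow P n c by apply: contrapT.
have [a [b [_ [_ [a0 nab hb _ _]]]]] := prime_inverse hP.
have pow n : ipow P n `<=` [set x | exists r, x * b ^+ n = a ^+ n * r].
  elim: n => [|n IH]; first by move=> x _; exists x; rewrite /= !expr0; ring.
  apply: imul_sub => [|p x Pp /IH [r er]].
    split; first by exists 0; ring.
    by move=> r x y [u eu] [v ev]; exists (r * u + v); rewrite mulrDl -mulrA eu ev; ring.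
  have [s _ es] := hb p Pp; exists (s * r).
  rewrite !exprS; transitivity ((b * p) * (x * b ^+ n)); first by ring.
  by rewrite -es er; ring.
apply: nab; pose G := [set r | exists n, c * b ^+ n = a ^+ n * r].
apply: (@stabilizer_integral (ideal_gen G)) => //.
  split; first exact: ideal_gen_ideal.
  by exists c => //; apply: sub_gen_smallest; exists 0%N; rewrite !expr0; ring.
have hL := ideal_gen_ideal G.
apply: (smallest_sub (ideal_transporter a b hL)) => r [n er].
have [s es] := pow n.+1 _ (allN n.+1).
exists s; first by apply: sub_gen_smallest; exists n.+1.
apply: (mulfI (expf_neq0 n a0)).
by rewrite mulrCA -er !mulrA -exprSr -es exprS; ring.
Qed.

(** Products of nonzero primes as an inductive predicate rather than through
lists: all uses are inductions on the number of factors. *)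
Inductive prime_product : set R -> Prop :=
| prime_product0 : prime_product setT
| prime_productS P I : nonzero_prime P -> prime_product I -> prime_product (imul P I).

Lemma prime_product_ideal I : prime_product I -> is_ideal I.
Proof. by case=> [|P J _ _]; [exact: idealT | exact: imul_ideal]. Qed.

(** If [I] is inside [P], then [I = P J] with [J = P^-1 I], and [J] is strictly
larger than [I] since [b / a] in [P^-1] cannot stabilize [I].  Noetherian
induction applies to [J]. *)
Lemma ideal_factorization I : nonzero_ideal I -> prime_product I.
Proof.
move=> [hI]; move: I hI; apply: noetherian_ind => // I hI IH nzI.
have [I1|nI1] := pselect (I 1); first by rewrite (ideal_unit hI I1); left.
have [P hP IP] := prime_over noethR (conj hI nzI) nI1.
have [a [b [q [d [a0 nab hb [Pq nPd] ebq]]]]] := prime_inverse hP.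
have [r [p [Pp e1]]] := prime_maximal noethR dimR hP nPd.
(* This is [P^-1 I], since [P^-1] is generated by [1] and [b / a]. *)
pose J := [set j | exists i k, [/\ I i, I k & a * j = b * i + a * k]].
have hJ : is_ideal J.
  split; first by exists 0, 0; rewrite !mulr0 addr0; split=> //; exact: ideal0.
  move=> s x y [i [k [Ii Ik e]]] [i' [k' [Ii' Ik' e']]].
  exists (s * i + i'), (s * k + k'); split;
    do ?[by apply: idealD => //; apply: ideal_mull].
  by rewrite mulrDr mulrCA e e'; ring.
have IJ : I `<=` J by move=> i Ii; exists 0, i; split=> //; [exact: ideal0 | ring].
have nIJ : I <> J.
  move=> eIJ; apply: nab; apply: (stabilizer_integral (conj hI nzI) a0) => i Ii.
  have [j _ ej] := hb i (IP i Ii); exists j => //; rewrite eIJ; exists i, 0.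
  by split=> //; [exact: ideal0 | rewrite ej; ring].
suff -> : I = imul P J.
  apply: prime_productS => //; apply: IH => //.
  by case: nzI => x /IJ Jx x0; exists x.
apply/seteqP; split=> [i Ii|].
  have [j _ ej] := hb i (IP i Ii).
  have Jj : J j by exists i, 0; split=> //; [exact: ideal0 | rewrite ej; ring].
  have eid : i * d = q * j.
    by apply: (mulfI a0); rewrite mulrCA -ebq mulrCA [a * (q * j)]mulrCA ej; ring.
  have -> : i = q * (r * j) + p * i by rewrite -[LHS]mulr1 e1 mulrDr mulrA eid; ring.
  by apply: (idealD (imul_ideal _ _)); apply: imul_in => //;
    [exact: ideal_mull | exact: IJ].
apply: imul_sub => // s j Ps [i [k [Ii Ik e]]].
have [t _ et] := hb s Ps.
have -> : s * j = t * i + s * k.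
  by apply: (mulfI a0); rewrite mulrCA e mulrDr !mulrA [s * b]mulrC -et; ring.
by apply: (idealD hI); apply: ideal_mull.
Qed.

End Dedekind.

(** * Factorization and the class group *)

Section Factorization.
Variable R : idomainType.
Hypothesis dedR : dedekind_domain R.
Implicit Types (a b c r x y z : R) (A B I J P Q : set R).

Let dimR : krull_dim_eq R 1. Proof. by case: dedR. Qed.

Lemma prime_imul P I J : prime_ideal P -> imul I J `<=` P -> I `<=` P \/ J `<=` P.
Proof.
move=> [_ _ primeP] IJP.
have [IP|/existsNP [x /not_implyP [Ix nPx]]] := pselect (I `<=` P).
  by left.
right=> y Jy; have /primeP [|//] : P (x * y) by apply: IJP; apply: imul_in.
by move=> /nPx.
Qed.

Lemma prime_ipow P Q n : prime_ideal Q -> ipow P n `<=` Q -> P `<=` Q.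
Proof.
by move=> hQ PQ x Px; apply: (prime_exp (n := n) hQ); apply: PQ; apply: ipow_in.
Qed.

Lemma radical_exponent I : prime_product I -> exists n, forall t,
  (forall Q, nonzero_prime Q -> I `<=` Q -> Q t) -> I (t ^+ n).
Proof.
elim=> [|P J hP /prime_product_ideal hJ [n hn]]; first by exists 0%N.
exists n.+1 => t ht; rewrite exprS; apply: imul_in.
  by apply: ht => //; apply: imul_subl; case: hP => -[].
by apply: hn => Q hQ JQ; apply: ht => //; apply: subset_trans JQ; apply: imul_subr.
Qed.

Lemma uniform_separation I c : prime_product I -> c != 0 -> exists N, forall Q,
  nonzero_prime Q -> I `<=` Q -> ~ ipow Q N c.
Proof.
move=> ppI c0; elim: ppI => [|P J hP _ [N hN]].
  by exists 0%N => Q [[_ nQ1 _] _] /(_ 1 Logic.I).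
have [M hM] := krull_intersection dedR hP c0.
exists (maxn M N) => Q hQ /(prime_imul hQ.1) [PQ|JQ].
  rewrite -(nonzero_prime_max dimR hP hQ.1 PQ) => hc; apply: hM.
  exact: ipow_anti (leq_maxl _ _) _ hc.
by move=> hc; apply: (hN Q hQ JQ); exact: ipow_anti (leq_maxr _ _) _ hc.
Qed.

Lemma primary_prime_power I P : nonzero_prime P -> prime_product I ->
  (forall Q, nonzero_prime Q -> I `<=` Q -> Q = P) -> exists m, I = ipow P m.
Proof.
move=> hP; elim=> [_|Q J hQ /prime_product_ideal hJ IH only]; first by exists 0%N.
have QP : Q = P by apply: only => //; apply: imul_subl; case: hQ => -[].
have [|m ->] := IH; last by exists m.+1; rewrite QP.
by move=> A hA JA; apply: only => //; apply: subset_trans JA; apply: imul_subr.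
Qed.

(** When [x] is nonzero, this says [V(x) = {P}]. *)
Definition isolates x P := P x /\ forall Q, nonzero_prime Q -> Q x -> Q = P.

Definition primes_isolated :=
  forall P, nonzero_prime P -> exists2 x, x != 0 & isolates x P.

Definition principal_power I := exists2 n, (0 < n)%N &
  exists2 c, c != 0 & ipow I n = principal c.

Lemma principal_power_imul I J : principal_power I -> principal_power J ->
  principal_power (imul I J).
Proof.
move=> [m m0 [c c0 ec]] [n n0 [d d0 ed]]; exists (m * n)%N; first by rewrite muln_gt0 m0.
exists (c ^+ n * d ^+ m); first by rewrite mulf_neq0 // expf_neq0.
by rewrite ipow_imul ipowM ec mulnC ipowM ed !ipow_principal imul_principal.
Qed.

Lemma isolated_principal_power : primes_isolated ->
  forall I, nonzero_ideal I -> principal_power I.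
Proof.
move=> iso I /(ideal_factorization dedR); elim=> [|P J hP _ IH].
  exists 1%N => //; exists 1; first exact: oner_neq0.
  by rewrite ipowT; apply/seteqP; split=> // x _; exists x => //; rewrite mul1r.
apply: principal_power_imul => //; have [x x0 [Px only]] := iso P hP.
have [||[|m] em] := primary_prime_power hP (I := principal x).
- by apply: ideal_factorization => //; exact: principal_nonzero.
- by move=> Q hQ xQ; apply: only => //; apply: xQ; exact: principal_gen.
- have [[hPi nP1 _] _] := hP; exfalso; apply: nP1.
  have : principal x 1 by rewrite em.
  by move=> [r _ <-]; apply: ideal_mulr.
- by exists m.+1 => //; exists x.
Qed.

Notation K := {fraction R}.

(** Every fractional ideal is [z A] with [A] an integral ideal, and products of
fractional ideals reduce to products of integral ideals in this form. *)
Definition scaled (z : K) A : set K := [set z * tofrac r | r in A].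

Lemma scaled_submodule (z : K) A : is_ideal A -> is_submodule (scaled z A).
Proof.
move=> hA; split; first by exists 0; [exact: ideal0 | rewrite tofrac0 mulr0].
move=> a _ _ [r Ar <-] [s As <-]; exists (a * r + s).
  by apply: idealD => //; apply: ideal_mull.
by rewrite tofracD tofracM mulrDr mulrCA.
Qed.

Lemma fractional_mul_scaled (z w : K) A B :
  fractional_ideal_mul (scaled z A) (scaled w B) = scaled (z * w) (imul A B).
Proof.
apply/seteqP; split.
  apply: smallest_sub; first by apply: scaled_submodule; exact: imul_ideal.
  move=> _ [_ [r Ar <-] [_ [s Bs <-] <-]]; exists (r * s); first exact: imul_in.
  by rewrite tofracM mulrACA.
set F := fractional_ideal_mul _ _.
have [F0 FL] : is_submodule F.
  split=> [M [[M0 _] _] //|a x y hx hy M hM].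
  by case: (hM) => -[_ ML] _; apply: ML; [apply: hx | apply: hy].
move=> _ [r hr <-]; move: r hr.
apply: (@imul_sub _ _ _ [set r | F (z * w * tofrac r)]) => [|r s Ar Bs /=].
  split=> /= [|a x y hx hy]; first by rewrite tofrac0 mulr0.
  by rewrite tofracD tofracM mulrDr mulrCA; apply: FL.
rewrite tofracM mulrACA; apply: sub_gen_smallest.
by exists (z * tofrac r); [exists r | exists (w * tofrac s) => //; exists s].
Qed.

Lemma fractional_exp_scaled (z : K) A n :
  fractional_ideal_exp (scaled z A) n = scaled (z ^+ n) (ipow A n).
Proof.
elim: n => [|n IH]; last by rewrite exprS -fractional_mul_scaled -IH.
by apply/seteqP; split=> [_ [r _ <-]|_ [r _ <-]]; exists r => //; rewrite ?expr0 ?mul1r.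
Qed.

Lemma scaled_principal (z : K) c : z != 0 -> c != 0 ->
  principal_fractional_ideal (scaled z (principal c)).
Proof.
move=> z0 c0; exists (z * tofrac c); first by rewrite mulf_neq0 // tofrac_eq0.
apply/seteqP; split=> [_ [_ [r _ <-] <-]|_ [r _ <-]].
  by exists r => //; rewrite tofracM mulrA.
by exists (c * r); [exists r | rewrite tofracM mulrA].
Qed.

Lemma fractional_scaled (I : set K) : nonzero_fractional_ideal I ->
  exists (z : K) A, [/\ z != 0, nonzero_ideal A & I = scaled z A].
Proof.
move=> [[I0 IL] [x Ix x0] [d d0 hd]].
have d0' : tofrac d != 0 by rewrite tofrac_eq0.
have Aid : is_ideal [set r | I ((tofrac d)^-1 * tofrac r)].
  split=> /= [|a r s hr hs]; first by rewrite tofrac0 mulr0.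
  by rewrite tofracD tofracM mulrDr mulrCA; apply: IL.
exists (tofrac d)^-1, [set r | I ((tofrac d)^-1 * tofrac r)]; split.
- by rewrite invr_eq0.
- split=> //; have [r er] := hd x Ix; exists r; first by rewrite /= -er mulKf.
  by rewrite -tofrac_eq0 -er mulf_neq0.
- apply/seteqP; split=> [y Iy|_ [r hr <-] //].
  by have [r er] := hd y Iy; exists r; rewrite /= -er mulKf.
Qed.

(** If [P^n = pR] with [n > 0], then [p] isolates [P].  Conversely an element
isolating [P] generates a power of [P], so that all primes, hence all products
of primes, have a principal power. *)
Lemma torsion_iff_isolated : torsion_class_group R <-> primes_isolated.
Proof.
split=> [tors P hP|iso I]; last first.
  move=> /fractional_scaled [z [A [z0 /(isolated_principal_power iso)]]].
  move=> [n n0 [c c0 ec]] ->; exists n => //; rewrite fractional_exp_scaled ec.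
  by apply: scaled_principal => //; rewrite expf_neq0.
have [[hPi nP1 primeP] [x Px x0]] := hP.
have [|n n0] := tors (scaled 1 P).
  split; first exact: scaled_submodule.
    by exists (tofrac x); [exists x => //; rewrite mul1r | rewrite tofrac_eq0].
  exists 1; first exact: oner_neq0.
  by move=> _ [r _ <-]; exists r; rewrite tofrac1 !mul1r.
rewrite fractional_exp_scaled expr1n => -[c c0 ec].
have [p Pnp ep] : scaled 1 (ipow P n) c.
  by rewrite ec; exists 1 => //; rewrite tofrac1 mulr1.
rewrite mul1r in ep; exists p; first by rewrite -tofrac_eq0 ep.
split; first by rewrite -(ipow1 hPi); exact: ipow_anti n0 _ Pnp.
move=> Q hQ Qp; apply: esym; apply: (nonzero_prime_max dimR hP hQ.1) => q Pq.
apply: (prime_exp (n := n) hQ.1).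
have [r _ er] : [set c * tofrac r | r in [set: R]] (tofrac (q ^+ n)).
  by rewrite -ec; exists (q ^+ n); [exact: ipow_in | rewrite mul1r].
have -> : q ^+ n = p * r by apply/eqP; rewrite -tofrac_eq -er tofracM ep.
by apply: ideal_mulr => //; case: hQ => -[].
Qed.

End Factorization.

(** * The Golomb topology and prime supports *)

(** The filter generated by the closures of the neighbourhoods of [x] is
coarser than the one generated by the intersections of closures of
neighbourhoods of [y] and of [z]. *)
Definition dominated (T : topologicalType) (x y z : T) :=
  forall U, nbhs x U -> exists V W,
    [/\ nbhs y V, nbhs z W & closure V `&` closure W `<=` closure U].

Lemma dominatedC (T : topologicalType) (x y z : T) :
  dominated x y z -> dominated x z y.
Proof.
move=> dom U /dom [V [W [nV nW VW]]]; exists W, V; split=> //.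
by rewrite setIC.
Qed.

Section GolombTopology.
Variable R : idomainType.
Implicit Types (a b c r : R) (I J P Q : set R) (x y z t : golomb R).

Definition gcoset x I : set (golomb R) := [set t | I (sval t - sval x)].

(** The cosets in the subbase that contain [x] can be recentred at [x], and
[imul I J] lies in both [I] and [J] and is still coprime to [x], so these
cosets form a base of neighbourhoods. *)
Lemma golomb_nbhsP x U : nbhs x U <-> exists I,
  [/\ nonzero_ideal I, coprime_to (sval x) I & gcoset x I `<=` U].
Proof.
rewrite nbhsE; split=> [[B [[D subD <-] [A DA Ax]] BU]|[I [nzI cop IU]]]; last first.
  exists (gcoset x I) => //; split; last first.
    by rewrite /gcoset /= subrr; apply: ideal0; case: nzI.
  exists [set gcoset x I]; last by rewrite bigcup_set1.
  move=> _ ->; exists [fset gcoset x I]%fset; last by rewrite set_fset1 bigcap_set1.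
  move=> W; rewrite in_fset1 => /eqP ->; apply/mem_set.
  exists (sval x), I; split=> //; first by apply/coprime_toP => //; case: nzI.
  apply/seteqP; split=> [t It|t [i Ii] /= e].
    by exists (sval t - sval x) => //; rewrite addrC subrK.
  by rewrite /gcoset /= -e addrAC subrr add0r.
have [F FS FA] : finI_from (@golomb_subbase R) id A := subD _ DA.
suff [I [nzI cop IF]] : exists I, [/\ nonzero_ideal I, coprime_to (sval x) I &
    forall W, W \in enum_fset F -> gcoset x I `<=` W].
  exists I; split=> // t It.
  have At : A t by rewrite -FA => W /= WF; apply: (IF W).
  by apply: BU; exists A.
have {}FS W : W \in enum_fset F -> golomb_subbase W /\ W x.
  move=> WF; split; first by apply/set_mem; apply: FS.
  by have {}Ax : A x by []; move: Ax; rewrite -FA => /(_ W WF).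
elim: (enum_fset F) FS => [|W s IH] FS.
  exists setT; split=> //; first by split=> //; exists 1 => //; exact: oner_neq0.
  by exists 0, 1; split=> //; ring.
have [J [nzJ copJ sJ]] : exists I, [/\ nonzero_ideal I, coprime_to (sval x) I &
    forall W, W \in s -> gcoset x I `<=` W].
  by apply: IH => V Vs; apply: FS; rewrite in_cons Vs orbT.
have [[a [I [nzI genI eW]]] Wx] := FS W (mem_head _ _).
have [hI _] := nzI; have [hJ _] := nzJ.
have {}Wx : coset a I (sval x) by rewrite eW in Wx.
have [i Ii ex] := Wx.
have copI : coprime_to (sval x) I.
  have [r [k [Ik e1]]] := (coprime_toP a hI).1 genI.
  exists r, (k - i * r); split; first by apply: idealB => //; apply: ideal_mulr.
  by rewrite e1 -ex; ring.
exists (imul I J); split; [exact: imul_nonzero | exact: coprime_to_imul | ].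
move=> V; rewrite in_cons => /orP[/eqP ->|Vs] t ht; last first.
  by apply: sJ Vs _ _; apply: imul_subr ht.
rewrite eW /=; exists (i + (sval t - sval x)); last by rewrite -ex; ring.
by apply: idealD => //; apply: imul_subl ht.
Qed.

Lemma gcoset_nbhs x I : nonzero_ideal I -> coprime_to (sval x) I ->
  nbhs x (gcoset x I).
Proof. by move=> nzI cop; apply/golomb_nbhsP; exists I; split. Qed.

(** If [t] is coprime to [J], then [t + J] is a neighbourhood of [t], and it
must meet [x + I]. *)
Lemma closure_gcoset_congr x t I J : nonzero_ideal J -> I `<=` J ->
  coprime_to (sval t) J -> closure (gcoset x I) t -> J (sval t - sval x).
Proof.
move=> nzJ IJ cop /(_ _ (gcoset_nbhs nzJ cop)) [w [/IJ Jx Jt]].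
have [hJ _] := nzJ.
have -> : sval t - sval x = (sval w - sval x) - (sval w - sval t) by ring.
exact: idealB.
Qed.

(** Any [K] coprime to [t] is coprime to [t^n], so [t - x] is in
[t^n (t - x) R + K], hence in [I + K]; thus [t + K] meets [x + I].  The common
point is corrected by a product [ik] if it happens to be [0].  The exponent
covers both [t] in the radical of [I] and mixed conditions where [t] is in some
primes over [I] and congruent to [x] at the others. *)
Lemma closure_gcoset_in x t I n : nonzero_ideal I ->
  I (sval t ^+ n * (sval t - sval x)) -> closure (gcoset x I) t.
Proof.
move=> [hI [i Ii i0]] It B /golomb_nbhsP [K [[hK [k Kk k0]] cop KB]].
have [w [w0 Ix Kt]] : exists w : R, [/\ w != 0, I (w - sval x) & K (w - sval t)].
  have [r [l [Kl e1]]] := coprime_to_exp n hK cop.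
  pose w := sval t - (sval t - sval x) * l.
  have Ix : I (w - sval x).
    have -> : w - sval x = sval t ^+ n * (sval t - sval x) * r.
      transitivity ((sval t - sval x) * (1 - l)); first by rewrite /w; ring.
      by rewrite e1; ring.
    exact: ideal_mulr.
  have Kt : K (w - sval t).
    have -> : w - sval t = - ((sval t - sval x) * l) by rewrite /w; ring.
    by apply: idealN => //; apply: ideal_mull.
  have [w0|w0] := eqVneq w 0; last by exists w.
  exists (i * k); split; first by rewrite mulf_neq0.
    rewrite w0 sub0r in Ix; apply: idealD => //; exact: ideal_mulr.
  by rewrite w0 sub0r in Kt; apply: idealD => //; exact: ideal_mull.
by exists (exist _ w w0); split=> //; apply: KB.
Qed.

(** The inclusion [V(x) <= V(y)]. *)
Definition supp_le x y := forall P, nonzero_prime P -> P (sval x) -> P (sval y).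

Hypothesis dedR : dedekind_domain R.
Let dimR : krull_dim_eq R 1. Proof. by case: dedR. Qed.
Let noethR : noetherian R. Proof. by case: dedR. Qed.

Lemma coprime_to_nsub P I a : prime_ideal P -> P a -> coprime_to a I ->
  exists2 i, I i & ~ P i.
Proof.
move=> [hP nP1 _] Pa [r [i [Ii e]]]; exists i => // Pi; apply: nP1.
by rewrite e; apply: idealD => //; apply: ideal_mulr.
Qed.

(** Let [P] contain [y] but not [x]; domination is contradicted on
[U = x + P^e] for a suitable [e], since closed neighbourhoods of [y] and [z]
have a common point [t] outside [P] with [t] not congruent to [x] modulo [P^e].
If [P] contains [z], neither neighbourhood restricts [t] modulo [P^e].
Otherwise [t] can be taken close to [z] at [P], and [P^e] separates [z] from
[x]. *)
Lemma dominated_supp_le x y z : x <> z -> dominated x y z -> supp_le y x.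
Proof.
move=> xz dom P hP Py; apply: contrapT => nPx.
have [[hPi nP1 primeP] [p Pp p0]] := hP.
(* Domination applied to [x + P^e], with membership in the closures of the
   neighbourhoods of [y] and [z] replaced by sufficient congruences. *)
have step e : exists I J, [/\ nonzero_ideal I, coprime_to (sval y) I,
    nonzero_ideal J, coprime_to (sval z) J &
    forall t : R, ~ P t -> I (t * (t - sval y)) -> J (t * (t - sval z)) ->
      ipow P e (t - sval x)].
  have nzPe := ipow_nonzero e (nonzero_prime_ideal hP).
  have copP (t : R) : ~ P t -> coprime_to t (ipow P e).
    by move=> nPt; apply/coprime_to_ipow/prime_maximal.
  have [V [W [/golomb_nbhsP [I [nzI copI IV]] /golomb_nbhsP [J [nzJ copJ JW]] VW]]] :=
    dom _ (gcoset_nbhs nzPe (copP _ nPx)).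
  exists I, J; split=> // t nPt It Jt.
  have t0 : t != 0 by apply/eqP => t0; apply: nPt; rewrite t0; exact: ideal0.
  pose u : golomb R := exist _ t t0.
  apply: (@closure_gcoset_congr x u (ipow P e) (ipow P e)) => //.
  - exact: copP.
  apply: VW; split; [apply: (closureS IV) | apply: (closureS JW)];
    by apply: (closure_gcoset_in (n := 1)); rewrite ?expr1.
have [Pz|nPz] := pselect (P (sval z)).
  have [e he] := krull_intersection dedR hP (mulf_neq0 (svalP x) p0).
  have [I [J [[hI _] copI [hJ _] copJ IJ]]] := step e.
  have [i Ii nPi] := coprime_to_nsub hP.1 Py copI.
  have [j Jj nPj] := coprime_to_nsub hP.1 Pz copJ.
  have nPij : ~ P (i * j) by move=> /primeP [].
  have nP1p : ~ P (1 + p) by move=> /(idealB hPi) /(_ Pp); rewrite addrK.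
  (* The multiples [ij] and [ij(1 + p)] of [ij] would both be congruent to [x]
     modulo [P^e], whence [xp] in [P^e]. *)
  have h (t : R) : t = 1 \/ t = 1 + p -> ipow P e (i * j * t - sval x).
    move=> ht; apply: IJ.
    - by move=> /primeP [//|]; case: ht => ->.
    - by rewrite -!mulrA; exact: ideal_mulr.
    - by rewrite -!mulrA; apply: (ideal_mull _ hJ); exact: ideal_mulr.
  have h1 := h 1 (or_introl erefl); have h2 := h _ (or_intror erefl).
  have hPe := ipow_ideal P e.
  apply: he.
  have -> : sval x * p = (i * j * (1 + p) - sval x) -
    (i * j * 1 - sval x) * (1 + p) - 0 by ring.
  rewrite subr0; apply: (idealB hPe) => //; exact: ideal_mulr.
have xz0 : sval x - sval z != 0.
  by apply/eqP => /subr0_eq e; apply: xz; apply: val_inj.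
have [e he] := krull_intersection dedR hP xz0.
have [I [J [[hI _] copI nzJ copJ IJ]]] := step e.
have [i Ii nPi] := coprime_to_nsub hP.1 Py copI.
have [c [k [nPc hc]]] := prime_part noethR dimR nzJ hP.
have nPci : ~ P (c * i) by move=> /primeP [].
have [r [q [Pq e1]]] :=
  coprime_to_ipow (e + k).+1 (prime_maximal noethR dimR hP nPci).
(* [t] is congruent to [z] modulo a high power of [P], is a multiple of [i],
   and the factor [c] makes up for the part of [J] prime to [P]. *)
pose t := sval z * (c * i) * r.
have tz : t - sval z = - (sval z * q).
  by rewrite /t -[in X in _ - X](mulr1 (sval z)) e1; ring.
have Pe_q : ipow P e q by apply: ipow_anti Pq; rewrite -addnS leq_addr.
have Pe_tz : ipow P e (t - sval z).
  by rewrite tz; apply: (idealN (ipow_ideal P e)); apply: (ideal_mull _ (ipow_ideal P e)).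
have P_tz : P (t - sval z).
  rewrite tz; apply: (idealN hPi); apply: (ideal_mull _ hPi).
  by rewrite -(ipow1 hPi); apply: ipow_anti Pq.
apply: he.
have -> : sval x - sval z = (t - sval z) - (t - sval x) by ring.
apply: (idealB (ipow_ideal P e)) => //; apply: IJ.
- by move=> Pt; apply: nPz; exact: ideal_subl hPi P_tz Pt.
- have -> : t * (t - sval y) = i * (sval z * c * r * (t - sval y)) by rewrite /t; ring.
  exact: ideal_mulr.
- have -> : t * (t - sval z) = c * q * - (sval z * sval z * i * r) by rewrite tz /t; ring.
  case: nzJ => hJ _; apply: (ideal_mulr _ hJ); apply: hc.
  by apply: ipow_anti Pq; rewrite -addnS -addSnnS addnC leq_addr.
Qed.

(** The primes over [I] contain neither [y] nor [z].  Take [N] such that no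
[Q^N], for [Q] a prime over [I], contains [z - y].  A point in the closures of
both [y + I^N] and [z + I^N] but outside [Q] would be congruent to both [y] and
[z] modulo [Q^N]; so it lies in all the primes over [I], that is, in the radical
of [I], and therefore in the closure of [x + I]. *)
Lemma supp_le_dominated x y z : y <> z -> supp_le y x -> supp_le z x ->
  dominated x y z.
Proof.
move=> yz yx zx U /golomb_nbhsP [I [nzI copx IU]].
have hI := nzI.1; have ppI := ideal_factorization dedR nzI.
have yz0 : sval z - sval y != 0.
  by apply/eqP => /subr0_eq e; apply: yz; apply: val_inj.
have [N hN] := uniform_separation dedR ppI yz0.
have [n hn] := radical_exponent ppI.
have cop w : supp_le w x -> coprime_to (sval w) (ipow I N).
  move=> wx; apply: coprime_to_ipow; apply: contrapT => /(coprime_toPn noethR nzI).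
  move=> [P [hP IP Pw]].
  have [i /IP Pi nPi] := coprime_to_nsub hP.1 (wx P hP Pw) copx.
  exact: nPi.
have nzL := ipow_nonzero N nzI.
exists (gcoset y (ipow I N)), (gcoset z (ipow I N)).
split; [exact: gcoset_nbhs (cop y yx) | exact: gcoset_nbhs (cop z zx) | ].
move=> t [ty tz]; apply: (closureS IU); apply: (closure_gcoset_in (n := n)) => //.
apply: (ideal_mulr _ hI); apply: hn => Q hQ IQ; apply: contrapT => nQt.
have nzQ := ipow_nonzero N (nonzero_prime_ideal hQ).
have copt : coprime_to (sval t) (ipow Q N) by apply/coprime_to_ipow/prime_maximal.
have sub := @ipow_mono _ _ _ N IQ.
have Qy := closure_gcoset_congr nzQ sub copt ty.
have Qz := closure_gcoset_congr nzQ sub copt tz.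
apply: (hN Q hQ IQ).
have -> : sval z - sval y = (sval t - sval y) - (sval t - sval z) by ring.
exact: idealB nzQ.1 Qy Qz.
Qed.

End GolombTopology.

(** * The order on points *)

Section Order.
Variable T : topologicalType.
Implicit Types x y z p b c d : T.

(** In a Golomb space and for [x] [ample], this is [V(y) <= V(x)]. *)
Definition below y x := y = x \/ exists z, [/\ z <> x, z <> y & dominated x y z].

(** Holds for all nonunits of a Dedekind domain, and for its units too as soon
as there are three of them. *)
Definition ample x := exists y z, [/\ y <> x, z <> x, y <> z & dominated x y z].

(** The second hypothesis expresses that [p] is below the join of [b] and [c],
without requiring a join to exist. *)
Definition join_prime p := forall b c, ample b -> ample c ->
  (forall d, ample d -> below b d -> below c d -> below p d) ->
  below p b \/ below p c.

End Order.

(** The topological property that characterizes torsion of the class group. *)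
Definition join_primes_separate (T : topologicalType) := forall x y : T,
  ample x -> ample y ->
  (forall p, ample p -> join_prime p -> below p x -> below p y) -> below x y.

Lemma closure_preimage (X Y : topologicalType) (f : X -> Y) (A : set Y) x :
  continuous f -> closure (f @^-1` A) x -> closure A (f x).
Proof. by move=> cf clx B /cf /clx [u [Au Bu]]; exists (f u). Qed.

Lemma dominated_homeo (X Y : topologicalType) (f : X -> Y) (g : Y -> X) x y z :
  cancel f g -> cancel g f -> continuous f -> continuous g ->
  dominated x y z -> dominated (f x) (f y) (f z).
Proof.
move=> fK gK cf cg dom U /cf /dom [V [W [nV nW VW]]].
exists (g @^-1` V), (g @^-1` W); split; try by apply: cg; rewrite fK.
move=> t [/(closure_preimage cg) tV /(closure_preimage cg) tW].
by rewrite -[t]gK; apply: closure_preimage => //; apply: VW.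
Qed.

Lemma below_homeo (X Y : topologicalType) (f : X -> Y) (g : Y -> X) y x :
  cancel f g -> cancel g f -> continuous f -> continuous g ->
  below y x -> below (f y) (f x).
Proof.
move=> fK gK cf cg [->|[z [zx zy dom]]]; [by left | right].
have fI := can_inj fK.
by exists (f z); split; [move=> /fI | move=> /fI | exact: dominated_homeo dom].
Qed.

Lemma ample_homeo (X Y : topologicalType) (f : X -> Y) (g : Y -> X) x :
  cancel f g -> cancel g f -> continuous f -> continuous g ->
  ample x -> ample (f x).
Proof.
move=> fK gK cf cg [y [z [yx zx yz dom]]]; have fI := can_inj fK.
by exists (f y), (f z); split; try (by move=> /fI); exact: dominated_homeo dom.
Qed.

Lemma join_primes_separate_homeo (X Y : topologicalType) :
  homeomorphic X Y -> join_primes_separate X -> join_primes_separate Y.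
Proof.
move=> [f [g [fK gK cf cg]]] sepX x y gx gy hxy.
have fb u v : below u v -> below (f u) (f v) by exact: below_homeo.
have gb u v : below u v -> below (g u) (g v) by exact: below_homeo.
have fa u : ample u -> ample (f u) by exact: ample_homeo.
have ga u : ample u -> ample (g u) by exact: ample_homeo.
rewrite -[x]gK -[y]gK; apply: (fb); apply: sepX; [exact: ga | exact: ga | ].
move=> p ap jp px; rewrite -[p]fK; apply: (gb); apply: hxy; first exact: fa.
  move=> b c ab ac H; rewrite -[b]gK -[c]gK.
  have [|||/fb|/fb] := jp (g b) (g c) _ _ _;
    [exact: ga | exact: ga | | by left | by right].
  move=> d ad bd cd; rewrite -[p]fK -[d]fK; apply: (gb); apply: H; first exact: fa.
    by rewrite -[b]gK; exact: fb.
  by rewrite -[c]gK; exact: fb.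
by rewrite -[x]gK; exact: fb.
Qed.

Lemma homeomorphic_sym (X Y : topologicalType) :
  homeomorphic X Y -> homeomorphic Y X.
Proof. by move=> [f [g [fK gK cf cg]]]; exists g, f. Qed.

Section GolombOrder.
Variable R : idomainType.
Hypothesis dedR : dedekind_domain R.
Implicit Types (a r : R) (I J P Q : set R) (x y z b c d p : golomb R).

Let dimR : krull_dim_eq R 1. Proof. by case: dedR. Qed.
Let noethR : noetherian R. Proof. by case: dedR. Qed.

Definition golomb_mul x y : golomb R :=
  exist (fun a : R => a != 0) _ (mulf_neq0 (svalP x) (svalP y)).

(** The auxiliary points are [x^2] and [x^3]: they have the same primes as [x],
and [x], [x^2], [x^3] are distinct because [x] is not a unit. *)
Lemma ample_nonunit x P : nonzero_prime P -> P (sval x) -> ample x.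
Proof.
move=> hP Px; have nx1 : sval x <> 1.
  by move=> e; case: hP => -[_ nP1 _] _; rewrite e in Px.
have nxx1 : sval x * sval x <> 1.
  by move=> e; case: hP => -[hPi nP1 _] _; apply: nP1; rewrite -e; apply: ideal_mull.
have x0 := svalP x.
have cancel1 (a : R) : sval x * a = sval x -> a = 1.
  by move=> e; apply: (mulfI x0); rewrite mulr1.
exists (golomb_mul x x), (golomb_mul x (golomb_mul x x)); split.
- by move=> /(congr1 sval) /cancel1.
- by move=> /(congr1 sval) /cancel1.
- by move=> /(congr1 sval) /(mulfI x0) /esym /cancel1.
apply: (supp_le_dominated dedR).
- by move=> /(congr1 sval) /(mulfI x0) /esym /cancel1.
- by move=> Q [[_ _ primeQ] _] /primeQ [].
- by move=> Q [[_ _ primeQ] _] /primeQ [//|/primeQ []].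
Qed.

(** Ampleness of [x] provides two points with support in [V(x)]; at least one
differs from [y] and serves as the auxiliary point. *)
Lemma ample_below x y : ample x -> below y x <-> supp_le y x.
Proof.
move=> [w [z [wx zx wz dom]]]; split=> [[->//|[u [ux _ domu]]]|yx].
  by apply: (dominated_supp_le dedR _ domu) => e; apply: ux.
have [e|/eqP yx0] := eqVneq y x; [by left | right].
have wsupp : supp_le w x by apply: (dominated_supp_le dedR _ dom) => e; apply: zx.
have zsupp : supp_le z x.
  by apply: (dominated_supp_le dedR _ (dominatedC dom)) => e; apply: wx.
have [e|/eqP wy] := eqVneq w y.
  exists z; split=> //; first by move=> e'; apply: wz; rewrite e e'.
  by apply: (supp_le_dominated dedR) => // e'; apply: wz; rewrite e e'.
exists w; split=> //.
by apply: (supp_le_dominated dedR) => // e'; apply: wy.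
Qed.

Lemma ample_mul x y : ample x -> ample (golomb_mul x y).
Proof.
move=> [w [z [wx zx wz dom]]].
have inj u v : golomb_mul u y = golomb_mul v y -> u = v.
  by move=> /(congr1 sval) /(mulIf (svalP y)) e; apply: val_inj.
have supp u : supp_le u x -> supp_le (golomb_mul u y) (golomb_mul x y).
  move=> ux P hP; have [[hPi _ primeP] _] := hP.
  by move=> /primeP [/(ux _ hP)|] h; [exact: ideal_mulr | exact: ideal_mull].
have wzy : golomb_mul w y <> golomb_mul z y by move=> /inj.
exists (golomb_mul w y), (golomb_mul z y); split=> //; try by move=> /inj.
apply: (supp_le_dominated dedR) => //; apply: supp.
  by apply: (dominated_supp_le dedR _ dom) => e; apply: zx.
by apply: (dominated_supp_le dedR _ (dominatedC dom)) => e; apply: wx.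
Qed.

(** Localization at [P] gives [a] outside [P] with [a P^k] inside [xR]; a prime
[Q] other than [P] that contains [x] does not contain [P^k]. *)
Lemma other_primes x P : nonzero_prime P -> exists2 a, ~ P a &
  forall Q, nonzero_prime Q -> Q (sval x) -> Q <> P -> Q a.
Proof.
move=> hP; have [a [k [nPa ha]]] :=
  prime_part noethR dimR (principal_nonzero (svalP x)) hP.
exists a => // Q hQ Qx QP; have [[hQi _ primeQ] _] := hQ.
apply: contrapT => nQa; apply: QP; apply: esym.
apply: (nonzero_prime_max dimR hP hQ.1); apply: (prime_ipow (n := k) hQ.1) => q /ha.
case=> r _ e; have /primeQ [//|//] : Q (a * q).
by rewrite -e; exact: ideal_mulr.
Qed.

(** An element isolating [P] is join-prime, since [P] contains [bc] only when
it contains [b] or [c]; so the join-primes below [x] determine [V(x)]. *)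
Lemma separate_of_isolated : primes_isolated R ->
  join_primes_separate (golomb R).
Proof.
move=> iso x y ax ay h; apply/ample_below => // P hP Px.
have [[hPi nP1 primeP] _] := hP.
have [p0 p00 [Pp only]] := iso P hP; pose p : golomb R := exist _ p0 p00.
have ap : ample p by exact: ample_nonunit hP _.
have psupp z : P (sval z) -> supp_le p z by move=> Pz Q hQ /(only Q hQ) ->.
have jp : join_prime p.
  move=> b c ab ac H.
  have abc := ample_mul c ab.
  have : below p (golomb_mul b c).
    apply: H => //; apply/ample_below => // Q [[hQ _ _] _] Qz;
      [exact: ideal_mulr | exact: ideal_mull].
  move=> /(ample_below _ abc) /(_ P hP Pp) /primeP [Pb|Pc]; [left | right];
    by apply/ample_below => //; apply: psupp.
have /(ample_below _ ay) : below p y.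
  by apply: h => //; apply/ample_below => //; exact: psupp.
by move=> /(_ P hP Pp).
Qed.

(** With [a] outside [P] but in all other primes of [V(p)], write
[1 = ar + b] with [b] in [P].  Then [V(p)] is covered by [V(b)] and [V(ar)],
but [Q] is not in [V(b)] and [P] is not in [V(ar)]. *)
Lemma join_prime_support p P Q : join_prime p -> nonzero_prime P ->
  nonzero_prime Q -> P (sval p) -> Q (sval p) -> Q = P.
Proof.
move=> jp hP hQ Pp Qp; apply: contrapT => QP.
have [[hPi nP1 primeP] _] := hP; have [[hQi nQ1 _] _] := hQ.
have [a nPa ha] := other_primes p hP.
have [r [b [Pb e1]]] := prime_maximal noethR dimR hP nPa.
have Qar : Q (a * r) by apply: ideal_mulr => //; exact: ha.
have nQb : ~ Q b by move=> Qb; apply: nQ1; rewrite e1; exact: idealD.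
have nPar : ~ P (a * r) by move=> Par; apply: nP1; rewrite e1; exact: idealD.
have b0 : b != 0 by apply/eqP => e; apply: nQb; rewrite e; exact: ideal0.
have ar0 : a * r != 0 by apply/eqP => e; apply: nPar; rewrite e; exact: ideal0.
pose bb : golomb R := exist _ b b0; pose cc : golomb R := exist _ (a * r) ar0.
have ab : ample bb by exact: ample_nonunit hP _.
have ac : ample cc by exact: ample_nonunit hQ _.
have [|/(ample_below _ ab) /(_ Q hQ Qp)|/(ample_below _ ac) /(_ P hP Pp)] // :=
  jp bb cc ab ac.
move=> d ad /(ample_below _ ad) bd /(ample_below _ ad) cd.
apply/ample_below => // S hS Sp.
have [e|SP] := pselect (S = P); first by apply: bd => //; rewrite e.
have [[hSi _ _] _] := hS.
by apply: cd => //; exact: (ideal_mulr _ hSi (ha S hS Sp SP)).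
Qed.

(** If [P] is not isolated, then no join-prime is in [P].  For [x] in [P] and [y]
outside [P] but in all other primes of [V(x)], the join-primes below [x] are
then below [y], while [x] is not. *)
Lemma isolated_of_separate : join_primes_separate (golomb R) ->
  primes_isolated R.
Proof.
move=> sep P hP; apply: contrapT => niso.
have other p : P (sval p) -> exists Q, [/\ nonzero_prime Q, Q (sval p) & Q <> P].
  move=> Pp; apply: contrapT => nex; apply: niso.
  exists (sval p); first exact: (svalP p).
  by split=> // Q hQ Qp; apply: contrapT => QP; apply: nex; exists Q.
have [[hPi nP1 _] [x0 Px0 x00]] := hP; pose x : golomb R := exist _ x0 x00.
have [a nPa ha] := other_primes x hP.
have a0 : a != 0 by apply/eqP => e; apply: nPa; rewrite e; exact: ideal0.
pose y : golomb R := exist _ a a0.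
have ax : ample x by exact: ample_nonunit hP _.
have ay : ample y.
  have [Q [hQ Qx QP]] := other x Px0.
  by apply: (@ample_nonunit y Q hQ); exact: (ha Q hQ Qx QP).
apply: nPa; suff /(ample_below _ ay) xy : below x y by apply: xy Px0.
apply: sep => // p ap jp /(ample_below _ ax) px; apply/ample_below => // Q hQ Qp.
suff QP : Q <> P by exact: (ha Q hQ (px Q hQ Qp) QP).
move=> QP; rewrite QP in hQ Qp; have [Q' [hQ' Q'p]] := other p Qp.
by apply; apply: join_prime_support jp _ _ _ _.
Qed.

Lemma torsion_iff_separate :
  torsion_class_group R <-> join_primes_separate (golomb R).
Proof.
split=> [/(torsion_iff_isolated dedR)|sep]; first exact: separate_of_isolated.
by apply/(torsion_iff_isolated dedR)/isolated_of_separate.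
Qed.

End GolombOrder.

Theorem theorem2p6 (R S : idomainType)
    (hR : dedekind_domain R) (hS : dedekind_domain S)
    (hRS : homeomorphic (golomb R) (golomb S)) :
  torsion_class_group R <-> torsion_class_group S.
Proof.
split=> [/(torsion_iff_separate hR) sep|/(torsion_iff_separate hS) sep].
  by apply/(torsion_iff_separate hS)/(join_primes_separate_homeo hRS).
by apply/(torsion_iff_separate hR)/(join_primes_separate_homeo (homeomorphic_sym hRS)).
Qed.
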